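(* Let $E$ be a Drinfeld $\mathbb{F}_q[t]$-module of rank $r$ over $\mathbb{C}_\infty$ with $\phi_t=\theta+\kappa_1\tau+\cdots+\kappa_r\tau^r$, $\kappa_r\ne0$, period lattice $\Lambda_E$, and extended logarithm $\overset{\rightarrow}{\log_E}:\mathbb{C}_\infty\to\mathbb{C}_\infty/\Lambda_E$ as defined in the context. Then for every $\xi\in\mathbb{C}_\infty$, \[ \overset{\rightarrow}{\log_E}(\phi_t(\xi))\equiv\theta\,\overset{\rightarrow}{\log_E}(\xi)\pmod{\Lambda_E}, \] where $\phi_t(\xi)=\theta\xi+\kappa_1\xi^q+\cdots+\kappa_r\xi^{q^r}$.
   Context: Notation: $q$ a prime power, $k=\mathbb{F}_q(\theta)$, $k_\infty$ its completion at $\infty$ with $|\theta|_\infty=q$, $\mathbb{C}_\infty$ the completion of an algebraic closure of $k_\infty$, $t$ an independent variable, $\tau c=c^q\tau$. $\exp_E$ is the unique $\mathbb{F}_q$-linear entire power series with $\exp_E(X)\equiv X\bmod X^q$ and $\exp_E(a(\theta)X)=\phi_a(\exp_E(X))$; $\Lambda_E=\ker\exp_E$. $\mathbb{T}=\{\sum c_it^i: |c_i|_\infty\to0\}$; $\mathbb{T}_\theta=\{\sum c_it^i: |c_i|_\infty q^i\to0\}$; $\mathbb{E}\subset\mathbb{T}$ the power series defining entire functions whose coefficients lie in a finite extension of $k_\infty$. Frobenius twist: $(\sum a_it^i)^{(n)}=\sum a_i^{q^n}t^i$ for $n\in\mathbb{Z}$, entrywise on matrices. $\Phi_E\in\mathrm{Mat}_r(\mathbb{C}_\infty[t])$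 has $1$'s on the superdiagonal, zeros elsewhere in the first $r-1$ rows, and last row $\big(\frac{t-\theta}{\kappa_r^{(-r)}},\frac{-\kappa_1^{(-1)}}{\kappa_r^{(-r)}},\dots,\frac{-\kappa_{r-1}^{(-r+1)}}{\kappa_r^{(-r)}}\big)$. Fix $\Psi_E\in\mathrm{GL}_r(\mathbb{T}_\theta)\cap\mathrm{Mat}_r(\mathbb{E})$ with $\Psi_E^{(-1)}=\Phi_E\Psi_E$. It is known that $\Lambda_E=\big(\mathrm{Mat}_{1\times r}(\mathbb{F}_q[t])\Psi_E^{-1}\mathbf{e}_1^{\mathrm{tr}}\big)|_{t=\theta}$, where $\mathbf{e}_1,\dots,\mathbf{e}_r$ is the standard basis of row vectors. Let $\wp_r(\mathbf{Z})=\mathbf{Z}-\mathbf{Z}^{(1)}$ on $\mathrm{Mat}_{1\times r}(\mathbb{T})$; it is surjective with fibers cosets of $\mathrm{Mat}_{1\times r}(\mathbb{F}_q[t])$ whose entries have the same radius of convergence as the target. Set $\overset{\rightarrow}{\mathscr{L}_0}(\mathbf{Z}):=\wp_r^{-1}(\mathbf{Z})$ in $\mathrm{Mat}_{1\times r}(\mathbb{T})/\mathrm{Mat}_{1\times r}(\mathbb{F}_q[t])$. For $\xi\in\mathbb{C}_\infty$, $\overset{\rightarrow}{\log_E}(\xi):=\big(\mathbf{f}\,\Psi_E^{-1}\mathbf{e}_1^{\mathrm{tr}}\big)|_{t=\theta}\bmod\Lambda_E$ for any $\mathbf{f}\in\overset{\rightarrow}{\mathscr{L}_0}(\xi\mathbf{e}_1\Psi_E)$.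 *)

(* Defs.v *)
From HB Require Import structures.
From mathcomp Require Import all_boot all_order all_algebra fieldext mxpoly.
From mathcomp Require Import boolp classical_sets reals topology normedtype.
From mathcomp Require Import sequences.

Set Implicit Arguments.
Unset Strict Implicit.
Unset Printing Implicit Defensive.

Import Order.TTheory GRing.Theory Num.Theory numFieldNormedType.Exports.

Local Open Scope classical_set_scope.
Local Open Scope ring_scope.

(** * Formal power series in one variable *)

Record fps (C : Type) := Fps { fps_coef : nat -> C }.
Arguments Fps {C}.
Arguments fps_coef {C}.

Coercion fps_coef : fps >-> Funclass.

HB.instance Definition _ (C : Type) := gen_eqMixin (fps C).
HB.instance Definition _ (C : Type) := gen_choiceMixin (fps C).

Lemma fpsP (C : Type) (f g : fps C) : (forall n, f n = g n) -> f = g.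
Proof. by case: f g => f [g] /= fg; congr Fps; apply/funext. Qed.

Section FpsRing.
Variable C : comNzRingType.
Implicit Types f g h : fps C.

Definition fps_add f g := Fps (fun n => f n + g n).
Definition fps_opp f := Fps (fun n => - f n).
Definition fps_zero : fps C := Fps (fun=> 0).
Definition fps_one : fps C := Fps (fun n => (n == 0%N)%:R).
Definition fps_mul f g := Fps (fun n => \sum_(i < n.+1) f i * g (n - i)%N).
Definition fps_scale (c : C) f := Fps (fun n => c * f n).

Fact fps_addA : associative fps_add.
Proof. by move=> f g h; apply: fpsP => n /=; rewrite addrA. Qed.
Fact fps_addC : commutative fps_add.
Proof. by move=> f g; apply: fpsP => n /=; rewrite addrC. Qed.
Fact fps_add0 : left_id fps_zero fps_add.
Proof. by move=> f; apply: fpsP => n /=; rewrite add0r. Qed.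
Fact fps_addN : left_inverse fps_zero fps_opp fps_add.
Proof. by move=> f; apply: fpsP => n /=; rewrite addNr. Qed.

HB.instance Definition _ :=
  GRing.isZmodule.Build (fps C) fps_addA fps_addC fps_add0 fps_addN.

Definition fps_trunc N f : {poly C} := \poly_(i < N) f i.

Lemma fps_mul_trunc N n f g : (n < N)%N ->
  fps_mul f g n = (fps_trunc N f * fps_trunc N g)`_n.
Proof.
move=> nN; rewrite coefM /=; apply: eq_bigr => i _.
have iN : (i < N)%N by apply: leq_ltn_trans nN; rewrite -ltnS.
by rewrite !coef_poly iN (leq_ltn_trans (leq_subr _ _) nN).
Qed.

Fact fps_mulC : commutative fps_mul.
Proof.
by move=> f g; apply: fpsP => n; rewrite !(@fps_mul_trunc n.+1)// mulrC.
Qed.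

Fact fps_mulA : associative fps_mul.
Proof.
move=> f g h; apply: fpsP => n.
have E u v w : fps_mul u (fps_mul v w) n =
    (fps_trunc n.+1 u * (fps_trunc n.+1 v * fps_trunc n.+1 w))`_n.
  rewrite [RHS]coefM; apply: eq_bigr => i _.
  rewrite (@fps_mul_trunc n.+1) ?ltnS ?leq_subr//.
  by rewrite coef_poly ltn_ord.
by rewrite [fps_mul (fps_mul f g) h]fps_mulC !E mulrA [in RHS]mulrC.
Qed.

Fact fps_mul1 : left_id fps_one fps_mul.
Proof.
move=> f; apply: fpsP => n /=; rewrite big_ord_recl /= mul1r subn0 big1 ?addr0//.
by move=> i _; rewrite mul0r.
Qed.

Fact fps_mulDl : left_distributive fps_mul fps_add.
Proof.
move=> f g h; apply: fpsP => n /=; rewrite -big_split /=.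
by apply: eq_bigr => i _; rewrite mulrDl.
Qed.

Fact fps_one_neq0 : fps_one != 0.
Proof.
by apply/eqP => /(congr1 (fun f : fps C => f 0%N)) /= /eqP; rewrite oner_eq0.
Qed.

HB.instance Definition _ := GRing.Zmodule_isComNzRing.Build (fps C)
  fps_mulA fps_mulC fps_mul1 fps_mulDl fps_one_neq0.

Fact fps_scaleA a b f : fps_scale a (fps_scale b f) = fps_scale (a * b) f.
Proof. by apply: fpsP => n /=; rewrite mulrA. Qed.
Fact fps_scale1 : left_id 1 fps_scale.
Proof. by move=> f; apply: fpsP => n /=; rewrite mul1r. Qed.
Fact fps_scaleDr : right_distributive fps_scale +%R.
Proof. by move=> a f g; apply: fpsP => n /=; rewrite mulrDr. Qed.
Fact fps_scaleDl f : {morph fps_scale^~ f : a b / a + b}.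
Proof. by move=> a b; apply: fpsP => n /=; rewrite mulrDl. Qed.

HB.instance Definition _ := GRing.Zmodule_isLmodule.Build C (fps C)
  fps_scaleA fps_scale1 fps_scaleDr fps_scaleDl.

Fact fps_scaleAl (a : C) f g : a *: (f * g) = a *: f * g.
Proof.
apply: fpsP => n /=; rewrite big_distrr /=.
by apply: eq_bigr => i _; rewrite mulrA.
Qed.

HB.instance Definition _ :=
  GRing.Lmodule_isLalgebra.Build C (fps C) fps_scaleAl.
HB.instance Definition _ := GRing.Lalgebra_isComAlgebra.Build C (fps C).

Definition fps_unit : {pred fps C} := fun f => `[< exists g, g * f = 1 >].
Definition fps_inv f := xget f [set g | g * f = 1].

Fact fps_mulVf : {in fps_unit, left_inverse 1 fps_inv *%R}.
Proof. by move=> f /asboolP fu; exact: (xgetPex f fu). Qed.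
Fact fps_unitP f g : g * f = 1 -> fps_unit f.
Proof. by move=> gf; apply/asboolP; exists g. Qed.
Fact fps_invr_out : {in [predC fps_unit], fps_inv =1 id}.
Proof.
move=> f /negP fu; rewrite /fps_inv; case: xgetP => // g _ gf.
by case: fu; exact: fps_unitP gf.
Qed.

HB.instance Definition _ := GRing.ComNzRing_hasMulInverse.Build (fps C)
  fps_mulVf fps_unitP fps_invr_out.

Definition fpsX : fps C := Fps (fun n => (n == 1%N)%:R).

Definition fps_dilate (c : C) f : fps C := Fps (fun n => c ^+ n * f n).

End FpsRing.

Arguments fpsX {C}.

(** * Nonarchimedean absolute values and completions *)

Section AbsoluteValues.
Variable R : realType.

Record is_absval (K : fieldType) (v : K -> R) : Prop := IsAbsval {
  absval_ge0 : forall x, 0 <= v x;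
  absval_eq0 : forall x, v x = 0 <-> x = 0;
  absvalM : forall x y, v (x * y) = v x * v y;
  absvalD : forall x y, v (x + y) <= Num.max (v x) (v y) }.

Definition abs_cvg (K : fieldType) (v : K -> R) (u : nat -> K) (l : K) : Prop :=
  (fun n => v (u n - l)) @ \oo --> (0 : R).

Definition abs_cauchy (K : fieldType) (v : K -> R) (u : nat -> K) : Prop :=
  forall e : R, 0 < e -> exists N, forall m n, (N <= m)%N -> (N <= n)%N ->
    v (u m - u n) < e.

Record is_completion (K L : fieldType) (vK : K -> R) (vL : L -> R)
    (iota : {rmorphism K -> L}) : Prop := IsCompletion {
  completion_absval : is_absval vL;
  completion_isometry : forall x, vL (iota x) = vK x;
  completion_dense : forall y (e : R), 0 < e -> exists x, vL (y - iota x) < e;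
  completion_complete : forall u, abs_cauchy vL u -> exists l, abs_cvg vL u l }.

Record is_algebraic_closure (K : fieldType) (L : closedFieldType)
    (vK : K -> R) (vL : L -> R)
    (iota : {rmorphism K -> L}) : Prop := IsAlgebraicClosure {
  algclosure_algebraic : forall x, algebraicOver iota x;
  algclosure_absval : is_absval vL;
  algclosure_isometry : forall x, vL (iota x) = vK x }.

End AbsoluteValues.

(** * The field C_oo *)

(* |a / b| = q ^ (deg a - deg b), where k = F_q(theta) is the fraction field of
   {poly F}, theta being the polynomial variable, and q = #|F|. *)
Definition absinf_poly (F : finFieldType) (R : realType) (a : {poly F}) : R :=
  if a == 0 then 0 else #|F|%:R ^+ (size a).-1.

Definition absinf (F : finFieldType) (R : realType)
    (x : {fraction {poly F}}) : R :=
  absinf_poly R (frac (repr x)).1 / absinf_poly R (frac (repr x)).2.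

(* k_oo, an algebraic closure of it and C_oo are determined by these axioms only
   up to isometric isomorphism; a [Cinf_tower] is any choice of the three. *)
Record Cinf_tower (F : finFieldType) (R : realType) := CinfTower {
  kinf : fieldType;
  kinf_abs : kinf -> R;
  k_kinf : {rmorphism {fraction {poly F}} -> kinf};
  kinfP : is_completion (@absinf F R) kinf_abs k_kinf;
  kbar : closedFieldType;
  kbar_abs : kbar -> R;
  kinf_kbar : {rmorphism kinf -> kbar};
  kbarP : is_algebraic_closure kinf_abs kbar_abs kinf_kbar;
  Cinf : fieldType;
  Cinf_abs : Cinf -> R;
  kbar_Cinf : {rmorphism kbar -> Cinf};
  CinfP : is_completion kbar_abs Cinf_abs kbar_Cinf }.

Section Drinfeld.
Variables (F : finFieldType) (R : realType) (K : Cinf_tower F R).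

Local Notation q := #|F|.
Local Notation C := (Cinf K).
Local Notation absC := (@Cinf_abs F R K).
Implicit Types f g : fps C.

Definition kinf_Cinf (x : kinf K) : C := kbar_Cinf K (kinf_kbar K x).

(* For a in F_q[t], [at_theta a] is a(theta) in C_oo. *)
Definition at_theta (a : {poly F}) : C := kinf_Cinf (k_kinf K (tofrac a)).
Definition theta : C := at_theta 'X.
Definition Fq_Cinf (c : F) : C := at_theta c%:P.

(** ** Convergence and the rings T, T_theta, E *)

Definition fps_sum f (x l : C) : Prop :=
  abs_cvg absC (fun n => \sum_(i < n) f i * x ^+ i) l.

Definition entire f : Prop := forall x, exists l, fps_sum f x l.

Definition Tate f : Prop := (fun i => absC (f i)) @ \oo --> (0 : R).

Definition Tate_theta f : Prop :=
  (fun i => absC (f i) * q%:R ^+ i) @ \oo --> (0 : R).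

(* A finite extension of k_oo inside C_oo is the image of a [fieldExtType] under
   a k_oo-embedding j. *)
Definition entire_finite f : Prop :=
  [/\ Tate f, entire f &
      exists (L : fieldExtType (kinf K)) (j : {rmorphism L -> C}),
        (forall x : kinf K, j x%:A = kinf_Cinf x) /\
        (forall i, exists y, f i = j y)].

Definition mx_over (P : fps C -> Prop) m n (A : 'M[fps C]_(m, n)) : Prop :=
  forall i j, P (A i j).

(** ** Frobenius twists *)

(* x ^ (q ^ n) for n : int; C_oo being perfect, q ^ m-th roots exist and are
   unique, so that [xget] picks the root. *)
Definition frob (n : int) (x : C) : C :=
  match n with
  | Posz m => x ^+ (q ^ m)
  | Negz m => xget 0 [set y | y ^+ (q ^ m.+1) = x]
  end.

Definition twist (n : int) f : fps C := Fps (fun i => frob n (f i)).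

Definition mx_twist (n : int) m p (A : 'M[fps C]_(m, p)) : 'M[fps C]_(m, p) :=
  map_mx (twist n) A.

(** ** Drinfeld modules *)

(* Only the values of kappa at 1, ..., r are used. *)
Record drinfeld_module := DrinfeldModule {
  rk : nat;
  rk_gt0 : (0 < rk)%N;
  kappa : nat -> C;
  kappa_rk_neq0 : kappa rk != 0 }.

Variable E : drinfeld_module.
Local Notation r := (rk E).

(* The algebra A is C_oo itself (written C^o) or the ring of power series. *)
Definition phi_t (A : comAlgType C) (x : A) : A :=
  theta *: x + \sum_(1 <= i < r.+1) kappa E i *: x ^+ (q ^ i).

(* phi is the F_q-algebra morphism to twisted polynomials extending t |-> phi_t;
   multiplication of twisted polynomials acts as composition. *)
Definition phi (a : {poly F}) (A : comAlgType C) (x : A) : A :=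
  \sum_(j < size a) Fq_Cinf a`_j *: iter j (@phi_t A) x.

Definition Fq_linear f : Prop :=
  (forall x y u v, fps_sum f x u -> fps_sum f y v ->
     fps_sum f (x + y) (u + v)) /\
  (forall (c : F) x u, fps_sum f x u ->
     fps_sum f (Fq_Cinf c * x) (Fq_Cinf c * u)).

Record is_exp f : Prop := IsExp {
  exp_Fq_linear : Fq_linear f;
  exp_entire : entire f;
  exp_modXq : forall n, (n < q)%N -> f n = (n == 1%N)%:R;
  exp_phi : forall a : {poly F}, fps_dilate (at_theta a) f = phi a f }.

Definition period_lattice (expE : fps C) : set C :=
  [set x | fps_sum expE x 0].

(** ** Phi_E, rigid analytic trivializations and the extended logarithm *)

Definition Phi : 'M[fps C]_r :=
  \matrix_(i < r, j < r)
    if (i.+1 < r)%N then (nat_of_ord j == i.+1)%:R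
    else (frob (- (r%:Z)) (kappa E r))^-1 *:
         (if nat_of_ord j == 0%N then fpsX - theta%:A
          else (- frob (- ((j : nat)%:Z)) (kappa E j))%:A).

Record is_trivialization (Psi : 'M[fps C]_r) : Prop := IsTrivialization {
  triv_unit : Psi \in unitmx;
  triv_Tate_theta : mx_over Tate_theta Psi;
  triv_inv_Tate_theta : mx_over Tate_theta (invmx Psi);
  triv_entire : mx_over entire_finite Psi;
  triv_eq : mx_twist (-1) Psi = Phi *m Psi }.

Definition e1 : 'rV[fps C]_r := \row_j (nat_of_ord j == 0%N)%:R.

Definition wp (Z : 'rV[fps C]_r) : 'rV[fps C]_r := Z - mx_twist 1 Z.

Definition L0 (Z : 'rV[fps C]_r) : set 'rV[fps C]_r :=
  [set u | mx_over Tate u /\ wp u = Z].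

(* Elements of C_oo / Lambda are represented by cosets, as subsets of C_oo. *)
Definition coset_of (Lambda : set C) (x : C) : set C :=
  [set y | Lambda (y - x)].

(* The union, over all u in L0 (xi e1 Psi), of the cosets of the values at
   t = theta of u Psi^-1 e1^tr. *)
Definition log_ext (expE : fps C) (Psi : 'M[fps C]_r) (xi : C) : set C :=
  [set y | exists (u : 'rV[fps C]_r) (l : C),
     [/\ L0 (xi%:A *: (e1 *m Psi)) u,
     fps_sum ((u *m invmx Psi *m e1^T) 0 0) theta l &
     coset_of (period_lattice expE) l y]].

End Drinfeld.

(* Main.v *)
(** Let [u] satisfy [u - u^(1) = xi e_1 Psi], put [g = u Psi^-1], and let [l] be
    the value of [g_1] at [theta].  The key point is that [exp_E l = xi]; then
    [log_E xi] is the whole fibre of [exp_E] over [xi], and the theorem is the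
    functional equation of [exp_E].

    Twisting [Psi^(-1) = Phi Psi] gives [(g - xi e_1) Phi^(1) = g^(1)].
    Eliminating all entries but the first yields [g_1 = (theta - t) e], where the
    coefficients of [e] satisfy [phi_t(e_0) = xi] and [phi_t(e_(n+1)) = e_n].
    The partial sums of [g_1] at [theta] telescope, so that
    [theta^(n+1) e_n --> l].  The differences [d_n = e_n - exp_E(l / theta^(n+1))]
    satisfy [phi_t(d_(n+1)) = d_n] and [theta^(n+1) d_n --> 0]; since
    [|phi_t(d)| = |theta d|] for small [d], the sequence [|theta^(n+1) d_n|] is
    eventually constant, hence zero, and [xi = phi_t(e_0) = exp_E l]. *)

Require Import Defs.
From HB Require Import structures.
From mathcomp Require Import all_boot all_order all_algebra fieldext mxpoly.
From mathcomp Require Import boolp classical_sets reals topology normedtype.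
From mathcomp Require Import sequences finfield archimedean ring.

Set Implicit Arguments.
Unset Strict Implicit.
Unset Printing Implicit Defensive.

Import Order.TTheory GRing.Theory Num.Theory numFieldNormedType.Exports.

Local Open Scope classical_set_scope.
Local Open Scope ring_scope.

(** * Real sequences tending to zero *)

Definition eventually_small (R : realType) (a : nat -> R) : Prop :=
  forall e : R, 0 < e -> exists N, forall n, (N <= n)%N -> a n < e.

Lemma eventually_smallP (R : realType) (a : nat -> R) : (forall n, 0 <= a n) ->
  a @ \oo --> (0 : R) <-> eventually_small a.
Proof.
move=> a0; split.
  move=> /cvgrPdist_lt H e e0; have [N _ HN] := H e e0.
  by exists N => n Nn; have := HN n Nn; rewrite /= sub0r normrN ger0_norm.
move=> H; apply/cvgrPdist_lt => e e0; have [N HN] := H e e0.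
by exists N => // n /= Nn; rewrite sub0r normrN ger0_norm// HN.
Qed.

Lemma eventually_small_expr (R : realType) (x : R) : 0 <= x -> x < 1 ->
  eventually_small (fun n => x ^+ n).
Proof.
move=> x0 x1; apply/eventually_smallP; first by move=> n; exact: exprn_ge0.
by apply: cvg_expr; rewrite ger0_norm.
Qed.

Lemma eventually_small_harmonic (R : realType) :
  eventually_small (fun n => n.+1%:R^-1 : R).
Proof.
move=> e e0; exists (Num.Def.truncn e^-1)%N => n Nn.
rewrite -[e]invrK ltf_pV2 ?posrE ?invr_gt0 ?ltr0n//.
by apply: lt_le_trans (truncnS_gt _) _; rewrite ler_nat ltnS.
Qed.

Lemma eventually_small_bounded (R : realType) (a : nat -> R) :
  eventually_small a -> exists2 M : R, 0 < M & forall n, a n <= M.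
Proof.
move=> /(_ 1 ltr01)[N HN].
have [M M0 HM] : exists2 M : R, 0 < M & forall n, (n < N)%N -> a n <= M.
  elim: N {HN} => [|N [M M0 HM]]; first by exists 1.
  exists (Num.max M (a N)); first by rewrite lt_max M0.
  move=> n; rewrite ltnS leq_eqVlt => /predU1P[->|nN].
    by rewrite le_max lexx orbT.
  by rewrite le_max HM.
exists (Num.max M 1); first by rewrite lt_max M0.
move=> n; rewrite le_max; have [nN|Nn] := ltnP n N; first by rewrite HM.
by rewrite (ltW (HN n Nn)) orbT.
Qed.

Lemma eventually_smallZ (R : realType) (c : R) (a : nat -> R) :
  0 <= c -> eventually_small a -> eventually_small (fun n => c * a n).
Proof.
move=> c0 ha e e0; have c1 : 0 < c + 1 by rewrite ltr_wpDl.
have [N HN] := ha _ (divr_gt0 e0 c1); exists N => n Nn.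
have [an|an] := ltP (a n) 0.
  by apply: le_lt_trans e0; rewrite mulr_ge0_le0// ltW.
have := HN n Nn; rewrite ltr_pdivlMr// mulrC; apply: le_lt_trans.
by rewrite ler_wpM2r// lerDl.
Qed.

(** If [i + j] is large then one of the two indices is large, and the other factor is bounded. This
    controls the terms of Cauchy products. *)
Lemma eventually_small_prod (R : realType) (a b : nat -> R) :
  (forall n, 0 <= a n) -> (forall n, 0 <= b n) ->
  eventually_small a -> eventually_small b ->
  forall e : R, 0 < e -> exists N, forall i j, (N <= i + j)%N -> a i * b j < e.
Proof.
move=> a0 b0 ha hb e e0.
have [A A0 hA] := eventually_small_bounded ha.
have [B B0 hB] := eventually_small_bounded hb.
have [N1 H1] := ha _ (divr_gt0 e0 B0).
have [N2 H2] := hb _ (divr_gt0 e0 A0).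
exists (N1 + N2)%N => i j Nij.
have [N1i|iN1] := leqP N1 i.
  have := H1 i N1i; rewrite ltr_pdivlMr//; apply: le_lt_trans.
  by rewrite ler_wpM2l.
have N2j : (N2 <= j)%N by rewrite -(leq_add2l N1) (leq_trans Nij)// leq_add2r ltnW.
have := H2 j N2j; rewrite ltr_pdivlMr// mulrC; apply: le_lt_trans.
by rewrite ler_wpM2r.
Qed.

(** * Nonarchimedean absolute values *)

Section AbsvalTheory.
Context {R : realType} {K : fieldType} {v : K -> R} (hv : is_absval v).

Lemma absv_ge0 x : 0 <= v x. Proof. exact: (absval_ge0 hv). Qed.
Hint Resolve absv_ge0 : core.

Lemma absv0 : v 0 = 0. Proof. exact/(absval_eq0 hv). Qed.

Lemma absv_gt0 x : (0 < v x) = (x != 0).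
Proof.
rewrite lt_def absv_ge0 andbT; apply: negbLR; rewrite negbK.
by apply/eqP/eqP => /(absval_eq0 hv).
Qed.

Lemma absv1 : v 1 = 1.
Proof.
have v1 : v 1 != 0 by rewrite gt_eqF// absv_gt0 oner_neq0.
by apply: (mulfI v1); rewrite -(absvalM hv) !mulr1.
Qed.

Lemma absvX n x : v (x ^+ n) = v x ^+ n.
Proof. by elim: n => [|n IH]; rewrite ?absv1// !exprS (absvalM hv) IH. Qed.

Lemma absvN x : v (- x) = v x.
Proof.
have h : v (-1) = 1.
  by apply/eqP; rewrite -(@eqrXn2 _ 2)// -absvX sqrrN expr1n absv1 expr1n.
by rewrite -mulN1r (absvalM hv) h mul1r.
Qed.

Lemma absvBC x y : v (x - y) = v (y - x).
Proof. by rewrite -absvN opprB. Qed.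

Lemma absvV x : v x^-1 = (v x)^-1.
Proof.
have [->|x0] := eqVneq x 0; first by rewrite invr0 absv0 invr0.
have vx : v x != 0 by rewrite gt_eqF// absv_gt0.
by apply: (mulfI vx); rewrite -(absvalM hv) !divff// absv1.
Qed.

Lemma absvD_lt e x y : v x < e -> v y < e -> v (x + y) < e.
Proof. by move=> xe ye; apply: le_lt_trans (absvalD hv x y) _; rewrite gt_max xe. Qed.

Lemma absvD_le e x y : v x <= e -> v y <= e -> v (x + y) <= e.
Proof. by move=> xe ye; apply: le_trans (absvalD hv x y) _; rewrite ge_max xe. Qed.

Lemma absvB_lt e x y : v x < e -> v y < e -> v (x - y) < e.
Proof. by move=> xe ye; apply: absvD_lt; rewrite ?absvN. Qed.

Lemma absv_sum_lt (I : Type) (s : seq I) (P : pred I) (f : I -> K) e : 0 < e ->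
  (forall i, P i -> v (f i) < e) -> v (\sum_(i <- s | P i) f i) < e.
Proof.
by move=> e0 h; elim/big_ind: _ => //; [rewrite absv0 | move=> x y; exact: absvD_lt].
Qed.

Lemma absv_sum_le (I : Type) (s : seq I) (P : pred I) (f : I -> K) e : 0 <= e ->
  (forall i, P i -> v (f i) <= e) -> v (\sum_(i <- s | P i) f i) <= e.
Proof.
by move=> e0 h; elim/big_ind: _ => //; [rewrite absv0 | move=> x y; exact: absvD_le].
Qed.

(** If [x + y] were smaller than [x], then [x], being the difference of [x + y] and [y], would be
    smaller than itself. *)
Lemma absvDl_eq x y : v y < v x -> v (x + y) = v x.
Proof.
move=> yx; apply/eqP; rewrite eq_le absvD_le ?(ltW yx)//=.
rewrite leNgt; apply/negP => h.
by have := absvB_lt h yx; rewrite addrK ltxx.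
Qed.

Lemma absv_small_eq0 x : (forall e, 0 < e -> v x < e) -> x = 0.
Proof.
move=> h; apply/eqP; rewrite -[_ == _]negbK -absv_gt0; apply/negP => /h.
by rewrite ltxx.
Qed.

Lemma abs_cvgP u l : abs_cvg v u l <-> eventually_small (fun n => v (u n - l)).
Proof. by apply: eventually_smallP. Qed.

Lemma abs_cvg_unique u l m : abs_cvg v u l -> abs_cvg v u m -> l = m.
Proof.
move=> /abs_cvgP hl /abs_cvgP hm; apply/eqP; rewrite -subr_eq0; apply/eqP.
apply: absv_small_eq0 => e e0.
have [N1 H1] := hl e e0; have [N2 H2] := hm e e0.
have -> : l - m = (u (maxn N1 N2) - m) - (u (maxn N1 N2) - l).
  by rewrite opprB [RHS]addrC addrA subrK.
by apply: absvB_lt; [apply: H2 | apply: H1]; rewrite leq_max leqnn ?orbT.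
Qed.

Lemma abs_cvgD u1 u2 l1 l2 : abs_cvg v u1 l1 -> abs_cvg v u2 l2 ->
  abs_cvg v (fun n => u1 n + u2 n) (l1 + l2).
Proof.
move=> /abs_cvgP h1 /abs_cvgP h2; apply/abs_cvgP => e e0.
have [N1 H1] := h1 e e0; have [N2 H2] := h2 e e0.
exists (maxn N1 N2) => n; rewrite geq_max => /andP[n1 n2].
by rewrite opprD addrACA; apply: absvD_lt; auto.
Qed.

Lemma abs_cvgZ c u l : abs_cvg v u l -> abs_cvg v (fun n => c * u n) (c * l).
Proof.
move=> /abs_cvgP h; apply/abs_cvgP => e e0.
have [N HN] := eventually_smallZ (absv_ge0 c) h e0; exists N => n Nn.
by rewrite -mulrBr (absvalM hv) HN.
Qed.

Lemma abs_cvg_shift u l : abs_cvg v (fun n => u n.+1) l -> abs_cvg v u l.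
Proof.
move=> /abs_cvgP h; apply/abs_cvgP => e e0; have [N HN] := h e e0.
by exists N.+1 => -[|n]// Nn; exact: HN.
Qed.

Lemma abs_cvg_bounded u l : abs_cvg v u l ->
  exists2 M : R, 0 < M & forall n, v (u n) <= M.
Proof.
move=> /abs_cvgP /eventually_small_bounded[M M0 HM].
exists (Num.max M (v l)); first by rewrite lt_max M0.
move=> n; rewrite -(subrK l (u n)); apply: absvD_le; rewrite le_max ?HM//.
by rewrite lexx orbT.
Qed.

Lemma abs_cvgM u1 u2 l1 l2 : abs_cvg v u1 l1 -> abs_cvg v u2 l2 ->
  abs_cvg v (fun n => u1 n * u2 n) (l1 * l2).
Proof.
move=> h1 h2; have [M M0 HM] := abs_cvg_bounded h1.
move/abs_cvgP: h1 => h1; move/abs_cvgP: h2 => h2; apply/abs_cvgP => e e0.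
have [N1 H1] := eventually_smallZ (absv_ge0 l2) h1 e0.
have [N2 H2] := eventually_smallZ (ltW M0) h2 e0.
exists (maxn N1 N2) => n; rewrite geq_max => /andP[n1 n2].
have -> : u1 n * u2 n - l1 * l2 = u1 n * (u2 n - l2) + l2 * (u1 n - l1).
  by rewrite !mulrBr addrA [l2 * u1 n]mulrC subrK [l2 * _]mulrC.
apply: absvD_lt; rewrite (absvalM hv); last exact: H1.
by apply: le_lt_trans (H2 n n2); rewrite ler_wpM2r.
Qed.

(** A nonzero limit has the same absolute value as every term closer to it than [v l]. *)
Lemma abs_cvg_le u l e : abs_cvg v u l -> (forall n, v (u n) <= e) -> v l <= e.
Proof.
move=> /abs_cvgP h hu; rewrite leNgt; apply/negP => el.
have l0 : 0 < v l by apply: le_lt_trans el; apply: le_trans (hu 0%N).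
have [N /(_ N (leqnn N)) HN] := h _ l0.
have := absvDl_eq HN; rewrite addrC subrK => uN.
by have := hu N; rewrite uN leNgt el.
Qed.

Definition null_seq (a : nat -> K) := eventually_small (fun n => v (a n)).

Lemma series_terms_null (a : nat -> K) l :
  abs_cvg v (fun n => \sum_(i < n) a i) l -> null_seq a.
Proof.
move=> /abs_cvgP h e e0; have [N HN] := h e e0; exists N => n Nn.
have -> : a n = (\sum_(i < n.+1) a i - l) - (\sum_(i < n) a i - l).
  by rewrite opprB addrA subrK big_ord_recr/= [_ + a n]addrC addrK.
by apply: absvB_lt; apply: HN => //; apply: leqW.
Qed.

Hypothesis complete : forall u, abs_cauchy v u -> exists l, abs_cvg v u l.

(** By the ultrametric inequality a block of the series is no larger than its largest term, so null
    terms already make the partial sums Cauchy. *)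
Lemma series_cvg (a : nat -> K) : null_seq a ->
  exists l, abs_cvg v (fun n => \sum_(i < n) a i) l.
Proof.
move=> ha; apply: complete => e e0; have [N HN] := ha e e0; exists N.
suff H m n : (N <= n)%N -> (n <= m)%N ->
    v (\sum_(i < m) a i - \sum_(i < n) a i) < e.
  move=> m n Nm Nn; have [nm|mn] := leqP n m; first exact: H.
  by rewrite absvBC; apply: H => //; apply: ltnW.
move=> Nn nm; rewrite -!(big_mkord xpredT) (big_cat_nat _ nm)//=.
rewrite addrAC subrr add0r.
rewrite big_seq; apply: absv_sum_lt => // i; rewrite mem_index_iota => /andP[ni _].
by apply: HN; exact: leq_trans ni.
Qed.

End AbsvalTheory.

(** * Cauchy products *)

Section PowerSeries.
Context {R : realType} {K : fieldType} {v : K -> R} (hv : is_absval v).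
Implicit Types f g : fps K.

(* Both sides are the value at [x] of the product of the truncated polynomials. *)
Lemma fps_mul_sum_tail f g x N :
  (\sum_(i < N) f i * x ^+ i) * (\sum_(i < N) g i * x ^+ i) =
  \sum_(i < N) (f * g) i * x ^+ i +
  \sum_(N <= n < N + N) \sum_(i < n.+1)
    ((fps_trunc N f)`_i * x ^+ i) * ((fps_trunc N g)`_(n - i) * x ^+ (n - i)).
Proof.
set A := fps_trunc N f; set B := fps_trunc N g.
have hA : \sum_(i < N) f i * x ^+ i = A.[x] by rewrite horner_poly.
have hB : \sum_(i < N) g i * x ^+ i = B.[x] by rewrite horner_poly.
rewrite hA hB -hornerM (@horner_coef_wide _ (N + N)); last first.
  apply: leq_trans (size_polyMleq _ _) _; apply: leq_trans (leq_pred _) _.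
  by rewrite leq_add ?size_poly.
rewrite -(big_mkord xpredT (fun i => (A * B)`_i * x ^+ i)).
rewrite (big_cat_nat _ (leq_addr N N))//= big_mkord; congr (_ + _).
  by apply: eq_bigr => i _; rewrite -(fps_mul_trunc _ _ (ltn_ord i)).
apply: eq_bigr => n _; rewrite coefM big_distrl /=; apply: eq_bigr => i _.
by rewrite mulrACA -exprD subnKC// -ltnS.
Qed.

(** The product of partial sums differs from the partial sum of the product by terms whose two
    indices add up to at least [N]; these are uniformly small. *)
Lemma abs_cvg_fps_mul f g x a b :
  abs_cvg v (fun n => \sum_(i < n) f i * x ^+ i) a ->
  abs_cvg v (fun n => \sum_(i < n) g i * x ^+ i) b ->
  abs_cvg v (fun n => \sum_(i < n) (f * g) i * x ^+ i) (a * b).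
Proof.
move=> hf hg; have /(abs_cvgP hv) hfg := abs_cvgM hv hf hg.
have fnull h c := @series_terms_null _ _ _ hv (fun i => h i * x ^+ i) c.
apply/(abs_cvgP hv) => e e0.
have [N1 H1] := eventually_small_prod (fun=> absv_ge0 hv _)
  (fun=> absv_ge0 hv _) (fnull f a hf) (fnull g b hg) e0.
have [N2 H2] := hfg e e0; exists (maxn N1 N2) => n; rewrite geq_max => /andP[n1 n2].
have := H2 n n2; rewrite fps_mul_sum_tail addrAC => h.
rewrite -[X in v X](addrK (\sum_(n <= m < n + n) \sum_(i < m.+1)
    ((fps_trunc n f)`_i * x ^+ i) * ((fps_trunc n g)`_(m - i) * x ^+ (m - i)))).
apply: (absvB_lt hv h); rewrite big_seq; apply: (absv_sum_lt hv) => // m.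
rewrite mem_index_iota => /andP[nm _]; apply: (absv_sum_lt hv) => // i _.
have him : (i + (m - i) = m)%N by rewrite subnKC// -ltnS.
rewrite !coef_poly; case: ifP => _; last by rewrite !mul0r absv0.
case: ifP => _; last by rewrite mul0r mulr0 absv0.
by rewrite (absvalM hv); apply: H1; rewrite him (leq_trans n1).
Qed.

(** * Power series whose coefficients decay at a given radius *)

(** Radius 1 gives the Tate algebra T and radius q gives T_theta, so closure properties are proved
    once for both. *)
Definition null_at_radius (rho : R) f : Prop :=
  eventually_small (fun i => v (f i) * rho ^+ i).

Lemma null_at_radiusM rho f g : 0 < rho ->
  null_at_radius rho f -> null_at_radius rho g -> null_at_radius rho (f * g).
Proof.
move=> rho0 hf hg e e0.
have pos (h : fps K) n : 0 <= v (h n) * rho ^+ n.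
  by rewrite mulr_ge0 ?(absv_ge0 hv)// exprn_ge0// ltW.
have [N HN] := eventually_small_prod (pos f) (pos g) hf hg e0.
exists N => n Nn; rewrite -ltr_pdivlMr ?exprn_gt0//.
apply: (absv_sum_lt hv); first by rewrite divr_gt0 ?exprn_gt0.
move=> i _; have hin : (i + (n - i) = n)%N by rewrite subnKC// -ltnS.
rewrite ltr_pdivlMr ?exprn_gt0// (absvalM hv) -[in rho ^+ n]hin exprD mulrACA.
by apply: HN; rewrite hin.
Qed.

Lemma null_at_radiusD rho f g : 0 < rho ->
  null_at_radius rho f -> null_at_radius rho g -> null_at_radius rho (f + g).
Proof.
move=> rho0 hf hg e e0; have [N1 H1] := hf e e0; have [N2 H2] := hg e e0.
exists (maxn N1 N2) => n; rewrite geq_max => /andP[n1 n2].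
have rn : 0 < rho ^+ n by rewrite exprn_gt0.
have := H1 n n1; have := H2 n n2; rewrite -!ltr_pdivlMr// => h2 h1.
exact: absvD_lt.
Qed.

Lemma null_at_radius0 rho : null_at_radius rho 0.
Proof. by move=> e e0; exists 0%N => n _; rewrite /= absv0// mul0r. Qed.

Lemma null_at_radius_nat rho n : null_at_radius rho n%:R.
Proof.
move=> e e0; exists 1%N => -[|i]// _; suff -> : (n%:R : fps K) i.+1 = 0.
  by rewrite absv0// mul0r.
by elim: n => [|n IH] //; rewrite -natr1 /= IH add0r.
Qed.

Lemma null_at_radiusZ rho c f :
  null_at_radius rho f -> null_at_radius rho (c *: f).
Proof.
move=> /(eventually_smallZ (absv_ge0 hv c)) hf e e0; have [N HN] := hf e e0.
by exists N => n Nn; rewrite /= (absvalM hv) -mulrA HN.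
Qed.

Lemma null_at_radius_sum rho (I : Type) (s : seq I) (P : pred I)
    (f : I -> fps K) : 0 < rho -> (forall i, P i -> null_at_radius rho (f i)) ->
  null_at_radius rho (\sum_(i <- s | P i) f i).
Proof.
move=> rho0 h; elim/big_ind: _ => //; first exact: null_at_radius0.
by move=> x y; exact: null_at_radiusD.
Qed.

Lemma null_at_radius_mulmx rho m n p (A : 'M[fps K]_(m, n))
    (B : 'M[fps K]_(n, p)) : 0 < rho ->
  (forall i j, null_at_radius rho (A i j)) ->
  (forall i j, null_at_radius rho (B i j)) ->
  forall i j, null_at_radius rho ((A *m B) i j).
Proof.
move=> rho0 hA hB i j; rewrite mxE; apply: null_at_radius_sum => // k _.
exact: null_at_radiusM.
Qed.

Lemma null_at_radius_le rho1 rho2 f : 0 <= rho1 -> rho1 <= rho2 ->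
  null_at_radius rho2 f -> null_at_radius rho1 f.
Proof.
move=> h0 h12 hf e e0; have [N HN] := hf e e0; exists N => n Nn.
apply: le_lt_trans (HN n Nn); rewrite ler_wpM2l ?absv_ge0//.
by rewrite lerXn2r ?nnegrE ?(le_trans h0).
Qed.

End PowerSeries.

(** * The field C_oo *)

Lemma abs_cvgX (R : realType) (K : fieldType) (v : K -> R) (u : nat -> K) l m :
  is_absval v -> abs_cvg v u l -> abs_cvg v (fun n => u n ^+ m) (l ^+ m).
Proof.
move=> hv h; elim: m => [|m IH].
  by apply/(abs_cvgP hv) => e e0; exists 0%N => n _; rewrite /= !expr0 subrr absv0.
have := abs_cvgM hv h IH; rewrite -exprS.
by under eq_fun do rewrite -exprS.
Qed.

Lemma absinf_X (F : finFieldType) (R : realType) :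
  absinf R (tofrac 'X : {fraction {poly F}}) = #|F|%:R.
Proof.
(* The representative chosen by [repr] need not be X / 1; equivalence only says that its numerator
   is X times its denominator, which suffices for degrees. *)
have E := FracField.equivf_r (Ratio ('X : {poly F}) 1).
rewrite !numden_Ratio ?oner_eq0// mul1r in E.
have -> : tofrac 'X = \pi_({fraction {poly F}})%qT (Ratio ('X : {poly F}) 1).
  by unlock FracField.tofrac.
rewrite /absinf -E /absinf_poly mulf_eq0 polyX_eq0 /=.
set d := (frac _).2; have d0 : d != 0 := denom_ratioP _.
rewrite (negbTE d0) (mulrC 'X) size_mulX//= -[size d]prednK ?size_poly_gt0//= exprS.
rewrite mulfK// expf_neq0// pnatr_eq0 -lt0n.
exact: ltnW (finNzRing_gt1 _).
Qed.

Section CinfTheory.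
Context {F : finFieldType} {R : realType} (K : Cinf_tower F R).
Local Notation q := #|F|.
Local Notation C := (Cinf K).
Local Notation v := (@Cinf_abs F R K).

Lemma Cinf_absval : is_absval v. Proof. exact: completion_absval (CinfP K). Qed.
Let hv := Cinf_absval.

Lemma card_gt1 : (1 < q)%N. Proof. exact: finNzRing_gt1. Qed.

Lemma pnat_card : [pchar C].-nat q.
Proof.
have [p pp pF] := finPcharP F.
have pC : p \in [pchar C].
  exact: (rmorph_pchar (kbar_Cinf K \o kinf_kbar K \o k_kinf K \o
    @tofrac {poly F} \o polyC : {rmorphism F -> C})).
rewrite (card_pprimeChar pF : q = _) pnatX; apply/orP; left.
by rewrite pnatE.
Qed.

Lemma card_neq0 : (q == 0)%N = false.
Proof. by have := card_gt1; case: q. Qed.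

Lemma exprqD n (x y : C) : (x + y) ^+ (q ^ n) = x ^+ (q ^ n) + y ^+ (q ^ n).
Proof. by apply: exprDn_pchar; rewrite pnatX pnat_card. Qed.

Lemma exprqN n (x : C) : (- x) ^+ (q ^ n) = - x ^+ (q ^ n).
Proof. by apply: exprNn_pchar; rewrite pnatX pnat_card. Qed.

Lemma expr0q n : 0 ^+ (q ^ n) = 0 :> C.
Proof. by rewrite expr0n expn_eq0 card_neq0. Qed.

Lemma exprq_sum n (I : Type) (s : seq I) (P : pred I) (f : I -> C) :
  (\sum_(i <- s | P i) f i) ^+ (q ^ n) = \sum_(i <- s | P i) f i ^+ (q ^ n).
Proof.
by apply: (big_morph (fun x : C => x ^+ (q ^ n)) (exprqD n) (expr0q n)).
Qed.

Lemma exprq_inj n : injective (fun x : C => x ^+ (q ^ n)).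
Proof.
move=> x y /eqP; rewrite -subr_eq0 -exprqN -exprqD expf_eq0 subr_eq0.
by move=> /andP[_ /eqP].
Qed.

Lemma Cinf_dense (x : C) (e : R) : 0 < e -> exists y, v (x - kbar_Cinf K y) < e.
Proof. exact: (completion_dense (CinfP K)). Qed.

(* The solution is the series [d + d^q + d^(q^2) + ...]. *)
Lemma artin_schreier_small (d : C) : v d < 1 ->
  exists z, z - z ^+ q = d /\ v z <= v d.
Proof.
move=> d1.
have small : null_seq (v := v) (fun n => d ^+ (q ^ n)).
  move=> e e0; have [N HN] := eventually_small_expr (absv_ge0 hv d) d1 e0.
  exists N => n Nn; apply: le_lt_trans (HN n Nn); rewrite (absvX hv).
  by rewrite ler_wiXn2l ?(absv_ge0 hv)// ?ltW// ltnW// ltn_expl ?card_gt1.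
have [z hz] := series_cvg hv (completion_complete (CinfP K)) small.
exists z; split.
  apply/eqP; rewrite subr_eq addrC; apply/eqP.
  (* The partial sum of length [n + 1] is [d] plus the q-th power of the one of length [n], since
     Frobenius is additive; pass to the limit. *)
  apply: (abs_cvg_unique hv hz); apply: (abs_cvg_shift hv).
  have hc : abs_cvg v (fun=> d) d.
    by apply/(abs_cvgP hv) => e e0; exists 0%N => n _; rewrite subrr absv0.
  have := abs_cvgD hv (abs_cvgX q hv hz) hc.
  congr (abs_cvg v _ _); apply/funext => n.
  rewrite big_ord_recl expn0 expr1 addrC; congr (_ + _).
  have := exprq_sum 1 (index_enum 'I_n) xpredT (fun i => d ^+ (q ^ i)).
  rewrite expn1 => ->; apply: eq_bigr => i _.
  by rewrite lift0 -exprM expnSr.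
apply: (abs_cvg_le hv hz) => n; apply: (absv_sum_le hv); first exact: absv_ge0.
move=> i _; rewrite (absvX hv) ler_iXnr ?(absv_ge0 hv) ?(ltW d1)//.
by rewrite expn_gt0 ltnW ?card_gt1.
Qed.

(* No algebraic closedness of C_oo is needed: approximate [c] by an element of
   kbar, where the equation is solvable, up to an error of absolute value < 1. *)
Lemma artin_schreier (c : C) :
  exists z, z - z ^+ q = c /\ (v c < 1 -> v z <= v c).
Proof.
have [c1|c1] := ltP (v c) 1.
  by have [z [zc zle]] := artin_schreier_small c1; exists z; split.
have [c' hc'] := Cinf_dense c ltr01.
have [z [hz _]] := artin_schreier_small hc'.
pose p := 'X^q - ('X - c'%:P).
have sp : size p != 1%N.
  rewrite size_polyDl size_polyXn ?eqSS ?card_neq0//.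
  by rewrite size_polyN size_XsubC !ltnS card_gt1.
have /closed_rootP[w] := sp.
rewrite /root !hornerE subr_eq0 => /eqP hw.
exists (z + kbar_Cinf K w); split=> //.
have := exprqD 1 z (kbar_Cinf K w); rewrite expn1 => ->.
by rewrite -rmorphXn hw rmorphB/= opprD addrACA hz subKr subrK.
Qed.

(** Approximate [x] by elements of kbar and take their q-th roots there. The roots form a Cauchy
    sequence because |a - b|^q = |a^q - b^q|, and the q-th power of their limit is [x]. *)
Lemma Cinf_perfect (x : C) : exists y, y ^+ q = x.
Proof.
have q0 : (0 < q)%N by rewrite ltnW// card_gt1.
have /choice[y hy] : forall n, exists y, v (x - kbar_Cinf K y ^+ q) < n.+1%:R^-1.
  move=> n; have n0 : 0 < n.+1%:R^-1 :> R by rewrite invr_gt0.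
  have [x' hx'] := Cinf_dense x n0.
  have sp : size ('X^q - x'%:P) != 1%N by rewrite size_XnsubC// eqSS card_neq0.
  have /closed_rootP[w] := sp.
  by rewrite /root !hornerE subr_eq0 => /eqP hw; exists w; rewrite -rmorphXn hw.
pose u n := kbar_Cinf K (y n).
have ux : abs_cvg v (fun n => u n ^+ q) x.
  apply/(abs_cvgP hv) => e e0.
  have [N HN] := @eventually_small_harmonic R e e0; exists N => n Nn.
  by rewrite (absvBC hv); apply: lt_trans (hy n) (HN n Nn).
have [l hl] : exists l, abs_cvg v u l.
  apply: (completion_complete (CinfP K)) => e e0.
  have eq0 : 0 < e ^+ q by rewrite exprn_gt0.
  have /(abs_cvgP hv) /(_ _ eq0)[N HN] := ux; exists N => m n Nm Nn.
  rewrite -(ltr_pXn2r q0) ?nnegrE ?(absv_ge0 hv) ?(ltW e0)//.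
  have := exprqD 1 (u m) (- u n); rewrite exprqN expn1 -(absvX hv) => ->.
  have -> : u m ^+ q - u n ^+ q = (u m ^+ q - x) - (u n ^+ q - x).
    by rewrite opprB addrA subrK.
  by apply: (absvB_lt hv); apply: HN.
exists l; apply: (abs_cvg_unique hv) ux; exact: abs_cvgX.
Qed.

Lemma Cinf_perfectn n (x : C) : exists y, y ^+ (q ^ n) = x.
Proof.
elim: n x => [|n IH] x; first by exists x; rewrite expn0 expr1.
have [y <-] := Cinf_perfect x; have [z <-] := IH y.
by exists z; rewrite expnSr exprM.
Qed.

(** Perfectness of C_oo guarantees that [xget] returns a genuine root and not its default 0. *)
Lemma frobNK n (x : C) : frob (- n%:Z) x ^+ (q ^ n) = x.
Proof.
case: n => [|n]; first by rewrite /= !expr1.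
exact: (@xgetPex _ 0 [set y | y ^+ (q ^ n.+1) = x] (Cinf_perfectn n.+1 x)).
Qed.

Lemma Cinf_abs_theta : v (theta K) = q%:R.
Proof.
rewrite /theta /at_theta /kinf_Cinf (completion_isometry (CinfP K)).
rewrite (algclosure_isometry (kbarP K)) (completion_isometry (kinfP K)).
exact: absinf_X.
Qed.

End CinfTheory.

(** * Division points from the twisted equation *)

Lemma fpsXM0 (C : comNzRingType) (f : fps C) : (fpsX * f) 0%N = 0.
Proof. by rewrite /= big_ord1 mul0r. Qed.

Lemma fpsXMS (C : comNzRingType) (f : fps C) n : (fpsX * f) n.+1 = f n.
Proof.
rewrite /= big_ord_recl mul0r add0r big_ord_recl /= mul1r subSS subn0.
by rewrite big1 ?addr0// => i _; rewrite mul0r.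
Qed.

Lemma mulmx_cancelr (A : pzRingType) m n p (M N : 'M[A]_(m, n))
    (P : 'M_(n, p)) (Q : 'M_(p, n)) :
  P *m Q = 1%:M -> M *m P = N *m P -> M = N.
Proof. by move=> PQ MN; rewrite -[M]mulmx1 -[N]mulmx1 -PQ !mulmxA MN. Qed.

(** * Nonnegative Frobenius twists as ring endomorphisms *)

Section Twist.
Context {F : finFieldType} {R : realType} {K : Cinf_tower F R}.
Local Notation q := #|F|.
Local Notation C := (Cinf K).
Local Notation v := (@Cinf_abs F R K).

Fact twist_is_zmod_morphism n : zmod_morphism (@twist F R K (Posz n)).
Proof. by move=> f g; apply: fpsP => i /=; rewrite exprqD exprqN. Qed.

Fact twist_is_monoid_morphism n : monoid_morphism (@twist F R K (Posz n)).
Proof.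
split=> [|f g]; apply: fpsP => i /=.
  by case: eqP; rewrite ?expr1n ?expr0q.
by rewrite exprq_sum; apply: eq_bigr => j _; rewrite exprMn.
Qed.

HB.instance Definition _ n := GRing.isZmodMorphism.Build (fps C) (fps C)
  (@twist F R K (Posz n)) (twist_is_zmod_morphism n).
HB.instance Definition _ n := GRing.isMonoidMorphism.Build (fps C) (fps C)
  (@twist F R K (Posz n)) (twist_is_monoid_morphism n).

Lemma twistZ n (c : C) (f : fps C) :
  twist (Posz n) (c *: f) = c ^+ (q ^ n) *: twist (Posz n) f.
Proof. by apply: fpsP => i /=; rewrite exprMn. Qed.

Lemma twistX n : twist (Posz n) (fpsX : fps C) = fpsX.
Proof. by apply: fpsP => i /=; case: eqP; rewrite ?expr1n ?expr0q. Qed.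

Lemma twist0 (f : fps C) : twist (Posz 0) f = f.
Proof. by apply: fpsP => i /=; rewrite expr1. Qed.

Lemma twist_twist m n (f : fps C) :
  twist (Posz m) (twist (Posz n) f) = twist (Posz (m + n)) f.
Proof. by apply: fpsP => i /=; rewrite -exprM -expnD addnC. Qed.

(** Allows the formula for the first entry of [g] to be checked after one twist, as
    [division_points] does. *)
Lemma twist_inj n : injective (@twist F R K (Posz n)).
Proof.
move=> f g fg; apply: fpsP => i; apply: (@exprq_inj _ _ K n).
exact: (congr1 (fun h : fps C => h i) fg).
Qed.

Lemma mx_twist_twistN1 m n (A : 'M[fps C]_(m, n)) :
  mx_twist 1 (mx_twist (-1) A) = A.
Proof.
apply/matrixP => i j; rewrite !mxE; apply: fpsP => k.
exact: (frobNK 1).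
Qed.

End Twist.

(** * Elimination in the twisted matrix equation *)

Section DivisionPoints.
Context {F : finFieldType} {R : realType} {K : Cinf_tower F R}.
Local Notation q := #|F|.
Local Notation C := (Cinf K).
Local Notation v := (@Cinf_abs F R K).
Context (E : drinfeld_module K).
Local Notation r := (rk E).

Lemma phi_tE (x : C) : phi_t E (x : C^o) =
  theta K * x + \sum_(i < r) kappa E i.+1 * x ^+ (q ^ i.+1).
Proof. by rewrite /phi_t big_add1 big_mkord. Qed.

Context (Psi : 'M[fps C]_r) (hPsi : is_trivialization Psi).
Context (xi : C) (u : 'rV[fps C]_r) (hu : wp u = xi%:A *: (e1 E *m Psi)).
Let g := u *m invmx Psi.
Let h := g - xi%:A *: e1 E.

(** The equation for [u] gives h Psi = u^(1) = g^(1) Psi^(1). Substituting Psi = Phi^(1) Psi^(1) on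
    the left, the invertible factor Psi^(1) cancels. *)
Lemma mulmx_twist_Phi : h *m mx_twist 1 (Phi E) = mx_twist 1 g.
Proof.
(* [tw] presents the twist as [map_mx] of a ring morphism, so that it commutes with matrix
   products. *)
pose tw m n (A : 'M[fps C]_(m, n)) := map_mx (@twist F R K (Posz 1)) A.
change (h *m tw _ _ (Phi E) = tw _ _ g).
have twM m n p (A : 'M_(m, n)) (B : 'M_(n, p)) :
    tw _ _ (A *m B) = tw _ _ A *m tw _ _ B.
  exact: map_mxM.
have Psiu := triv_unit hPsi.
have ug : g *m Psi = u by rewrite mulmxKV.
have PsiE : Psi = tw _ _ (Phi E) *m tw _ _ Psi.
  by rewrite -twM -(triv_eq hPsi); exact/esym/mx_twist_twistN1.
have twV : tw _ _ Psi *m tw _ _ (invmx Psi) = 1%:M.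
  by rewrite -twM mulmxV// /tw map_mx1.
have H : h *m Psi = tw _ _ g *m tw _ _ Psi.
  rewrite mulmxBl -scalemxAl -hu /wp ug opprB addrC subrK -twM ug.
  by [].
have {}H : h *m tw _ _ (Phi E) *m tw _ _ Psi = tw _ _ g *m tw _ _ Psi.
  by rewrite -mulmxA -PsiE.
exact: (mulmx_cancelr twV H).
Qed.

Let o0 : 'I_r := Ordinal (rk_gt0 E).
Fact rk_pred_lt : (r.-1 < r)%N. Proof. by rewrite prednK// rk_gt0. Qed.
Let olast : 'I_r := Ordinal rk_pred_lt.
(* [a j] is [kappa_j^(1 - j)], written without a case distinction on the sign of
   the exponent. *)
Let a j : C := frob (- (j%:Z)) (kappa E j) ^+ q.
(* [m] is the Frobenius twist of the series [- e] of the file header. *)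
Let m : fps C := (a r)^-1 *: h 0 olast.

Lemma expr_twisted_kappa j : a j.+1 ^+ (q ^ j) = kappa E j.+1.
Proof. by rewrite -exprM -expnS frobNK. Qed.

Lemma twisted_kappa_neq0 : a r != 0.
Proof.
apply/negP => /eqP ar; have := kappa_rk_neq0 E.
have := expr_twisted_kappa r.-1; rewrite prednK ?rk_gt0// ar expr0q => <-.
by rewrite eqxx.
Qed.

(** The superdiagonal of [Phi] contributes the sum, its last row the other term. The twisted
    denominator of that row is [a r], which together with the last entry of [h] forms [m]. *)
Lemma sum_twist_Phi j :
  \sum_(i < r) h 0 i * twist (Posz 1) (Phi E i j) =
  (\sum_(i < r) h 0 i * (nat_of_ord j == i.+1)%:R) +
  (if nat_of_ord j == 0%N then (fpsX - (theta K ^+ q)%:A) * m else - (a j *: m)).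
Proof.
rewrite (bigD1 olast)//= [in RHS](bigD1 olast)//=.
(* For the last index the superdiagonal condition would read [j = r], which is impossible. *)
rewrite prednK ?rk_gt0// (ltn_eqF (ltn_ord j)) mulr0 add0r addrC; congr (_ + _).
  apply: eq_bigr => i /negP il; rewrite [Phi E i _]mxE ifT ?rmorph_nat//.
  rewrite ltn_neqAle ltn_ord andbT; apply/negP => /eqP ir; apply: il.
  by apply/eqP/val_inj; exact: (congr1 predn ir).
rewrite [Phi E olast _]mxE /= prednK ?rk_gt0// ltnn twistZ expn1 exprVn -/(a r).
rewrite -scalerAr scalerAl -/m.
case: ifP => _; first by rewrite rmorphB /= twistX twistZ rmorph1 expn1 mulrC.
by rewrite twistZ rmorph1 exprqN expn1 scaleNr mulrN -scalerAr mulr1.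
Qed.

Lemma h0E : h 0 o0 = g 0 o0 - xi%:A.
Proof. by rewrite /h !mxE /= mulr1. Qed.

Lemma hE (j : 'I_r) : (0 < j)%N -> h 0 j = g 0 j.
Proof. by rewrite lt0n => /negbTE j0; rewrite /h !mxE j0 mulr0 subr0. Qed.

Lemma twist_g j : twist (Posz 1) (g 0 j) =
  (\sum_(i < r) h 0 i * (nat_of_ord j == i.+1)%:R) +
  (if nat_of_ord j == 0%N then (fpsX - (theta K ^+ q)%:A) * m else - (a j *: m)).
Proof.
rewrite -sum_twist_Phi; have /matrixP/(_ 0 j) := mulmx_twist_Phi.
rewrite [RHS]mxE => <-; rewrite [LHS]mxE; apply: eq_bigr => i _.
by congr (_ * _); rewrite [LHS]mxE.
Qed.

Lemma twist_g0 : twist (Posz 1) (g 0 o0) = (fpsX - (theta K ^+ q)%:A) * m.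
Proof.
rewrite twist_g /= big1 ?add0r// => i _.
by rewrite mulr0.
Qed.

(** Column [j = i + 1] of the matrix equation reads g_j^(1) = h_i - a_j m, and [h] agrees with [g]
    away from the first entry. *)
Lemma h_step (i j : 'I_r) : nat_of_ord j = i.+1 ->
  h 0 i = twist (Posz 1) (h 0 j) + a i.+1 *: m.
Proof.
move=> ji; rewrite (@hE j) ?ji// twist_g ji /= (bigD1 i)//= eqxx mulr1 big1 ?addr0.
  by rewrite subrK.
move=> i' i'i; rewrite eqSS [_ == _](_ : _ = false) ?mulr0//.
by apply/negbTE; apply: contraNneq i'i => e; apply/eqP/val_inj.
Qed.

(** Iterates [h_step]; the k-fold twist turns the coefficient a_(k+1) into kappa_(k+1). *)
Lemma h0_expand k (kr : (k < r)%N) : h 0 o0 =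
  \sum_(i < k) kappa E i.+1 *: twist (Posz i) m + twist (Posz k) (h 0 (Ordinal kr)).
Proof.
elim: k kr => [|k IH] kr.
  by rewrite big_ord0 add0r twist0; congr (h 0 _); apply: val_inj.
have kr' := ltnW kr; rewrite (IH kr') big_ord_recr/= -addrA; congr (_ + _).
rewrite (@h_step (Ordinal kr') (Ordinal kr))//.
rewrite -(expr_twisted_kappa k) -(twistZ k (a k.+1) m).
have -> f : twist (Posz k.+1) f = twist (Posz k) (twist (Posz 1) f).
  by rewrite twist_twist addn1.
rewrite [RHS]addrC.
exact: rmorphD.
Qed.

(** At [k = r - 1] the remaining entry is a_r m, whose twist supplies the missing summand with
    kappa_r. *)
Lemma h0_kappa : h 0 o0 = \sum_(i < r) kappa E i.+1 *: twist (Posz i) m.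
Proof.
have split_last (f : nat -> fps C) n : (0 < n)%N ->
    \sum_(i < n) f i = \sum_(i < n.-1) f i + f n.-1.
  by case: n => // n _; rewrite big_ord_recr.
rewrite (h0_expand rk_pred_lt) -/olast.
have -> : h 0 olast = a r *: m.
  by rewrite /m scalerA mulfV ?scale1r// twisted_kappa_neq0.
have := expr_twisted_kappa r.-1; rewrite prednK ?rk_gt0// => ar.
rewrite twistZ ar.
rewrite (split_last (fun i => kappa E i.+1 *: twist (Posz i) m) r (rk_gt0 E)).
by rewrite prednK ?rk_gt0.
Qed.

(** Compare the n-th coefficients of [h0_kappa] and of g_1 = (theta - t) e. The term before [e 0] is
    0 in the coefficients of g_1 but [xi] along the orbit, because h_1 = g_1 - xi. *)
Lemma division_points : exists e : nat -> C,
  (forall n, phi_t E (e n : C^o) = if n is n'.+1 then e n' else xi) /\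
  (forall n, g 0 o0 n = theta K * e n - (if n is n'.+1 then e n' else 0)).
Proof.
(* Perfectness allows [- m] to be untwisted coefficient by coefficient. *)
have /choice[e he] n : exists y, y ^+ q = - m n by exact: Cinf_perfect.
have twe : twist (Posz 1) (Fps e) = - m.
  by apply: fpsP => n; rewrite /= expn1 he.
have twSe i : twist (Posz i) m = - twist (Posz i.+1) (Fps e).
  by rewrite -addn1 -twist_twist twe rmorphN opprK.
have gE : g 0 o0 = ((theta K)%:A - fpsX) * Fps e.
  apply: (@twist_inj _ _ _ 1); rewrite twist_g0 rmorphM /= twe rmorphB /= twistX.
  by rewrite twistZ rmorph1 expn1 mulrN -mulNr opprB.
have XE n : (fpsX * Fps e) n = if n is n'.+1 then e n' else 0.
  by case: n => [|n]; rewrite ?fpsXM0 ?fpsXMS.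
have gE' n : g 0 o0 n = theta K * e n - (if n is n'.+1 then e n' else 0).
  by rewrite gE mulrBl -scalerAl mul1r -XE.
exists e; split => // n.
have : h 0 o0 n = - \sum_(i < r) kappa E i.+1 * e n ^+ (q ^ i.+1).
  rewrite h0_kappa -sumrN.
  have coefD : {morph (fun f : fps C => f n) : f1 f2 / f1 + f2} by [].
  rewrite (big_morph (fun f : fps C => f n) coefD (erefl _)); apply: eq_bigr => i _.
  by rewrite twSe /= mulrN.
rewrite h0E [LHS]/= -[fps_coef (g 0 o0) n]/(g 0 o0 n) gE' phi_tE => H.
have -> : \sum_(i < r) kappa E i.+1 * e n ^+ (q ^ i.+1) =
  - (theta K * e n - (if n is n'.+1 then e n' else 0) - xi * (n == 0%N)%:R).
  by rewrite -[LHS]opprK -H.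
rewrite !opprB addrC -addrA subrK.
by case: n {H} => [|n] /=; rewrite ?mulr1 ?addr0 ?mulr0 ?add0r.
Qed.

End DivisionPoints.

(** * Evaluation of power series and the exponential *)

Section Evaluation.
Context {F : finFieldType} {R : realType} {K : Cinf_tower F R}.
Local Notation q := #|F|.
Local Notation C := (Cinf K).
Local Notation v := (@Cinf_abs F R K).
Implicit Types f g : fps C.
Let hv := Cinf_absval K.

Lemma fps_sum_unique f x a b : fps_sum f x a -> fps_sum f x b -> a = b.
Proof. exact: abs_cvg_unique. Qed.

Lemma fps_sumD f g x a b :
  fps_sum f x a -> fps_sum g x b -> fps_sum (f + g) x (a + b).
Proof.
move=> fa gb; have := abs_cvgD hv fa gb; congr (abs_cvg v _ _).
apply/funext => n; rewrite -big_split; apply: eq_bigr => i _.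
by rewrite mulrDl.
Qed.

Lemma fps_sumZ c f x a : fps_sum f x a -> fps_sum (c *: f) x (c * a).
Proof.
move=> fa; have := abs_cvgZ hv c fa; congr (abs_cvg v _ _).
apply/funext => n; rewrite mulr_sumr; apply: eq_bigr => i _.
by rewrite mulrA.
Qed.

Lemma fps_sum_finite f x N : (forall n, (N <= n)%N -> f n = 0) ->
  fps_sum f x (\sum_(i < N) f i * x ^+ i).
Proof.
move=> fN; apply/(abs_cvgP hv) => e e0; exists N => n Nn.
rewrite -!(big_mkord xpredT (fun i => f i * x ^+ i)).
rewrite (big_cat_nat _ Nn)//=.
rewrite addrAC subrr add0r.
rewrite big_nat big1 ?absv0// => i /andP[Ni _].
by rewrite fN// mul0r.
Qed.

Lemma fps_sumX f x a n : fps_sum f x a -> fps_sum (f ^+ n) x (a ^+ n).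
Proof.
move=> fa; elim: n => [|n IH]; last by rewrite !exprS; exact: abs_cvg_fps_mul.
have h : forall n, (1 <= n)%N -> (1 : fps C) n = 0 by case.
by have := fps_sum_finite x h; rewrite big_ord1 /= mul1r.
Qed.

Lemma fps_sum0 (x : C) : fps_sum (0 : fps C) x 0.
Proof.
by have := @fps_sum_finite (0 : fps C) x 0 (fun n _ => erefl); rewrite big_ord0.
Qed.

Lemma fps_sum_sum x (I : Type) (s : seq I) (P : pred I) (f : I -> fps C) a :
  (forall i, P i -> fps_sum (f i) x (a i)) ->
  fps_sum (\sum_(i <- s | P i) f i) x (\sum_(i <- s | P i) a i).
Proof.
move=> h; apply: (big_ind2 (fun f a => fps_sum f x a)) => //.
  exact: fps_sum0.
by move=> f1 a1 f2 a2; exact: fps_sumD.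
Qed.

Lemma fps_sum_dilate c f x a : fps_sum f (c * x) a -> fps_sum (fps_dilate c f) x a.
Proof.
congr (abs_cvg v _ _); apply/funext => n; apply: eq_bigr => i _.
by rewrite /= exprMn mulrCA mulrA.
Qed.

Lemma null_radius_fps_sum f : null_at_radius (v := v) q%:R f ->
  exists l, fps_sum f (theta K) l.
Proof.
move=> hf.
apply: (series_cvg hv (completion_complete (CinfP K))
  (a := fun i => f i * theta K ^+ i)).
move=> e e0; have [N HN] := hf e e0; exists N => n Nn.
by rewrite (absvalM hv) (absvX hv) Cinf_abs_theta HN.
Qed.

Lemma TateP f : Tate f <-> null_at_radius (v := v) 1 f.
Proof.
have -> : null_at_radius (v := v) 1 f = eventually_small (fun i => v (f i)).
  by congr eventually_small; apply/funext => i; rewrite expr1n mulr1.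
by apply: eventually_smallP => n; exact: absv_ge0.
Qed.

Lemma Tate_thetaP f : Tate_theta f <-> null_at_radius (v := v) q%:R f.
Proof.
by apply: eventually_smallP => n; rewrite mulr_ge0 ?exprn_ge0// (absv_ge0 hv).
Qed.

Lemma card_gt0R : 0 < q%:R :> R.
Proof. by rewrite ltr0n ltnW// card_gt1. Qed.

Lemma card_ge1 : 1 <= q%:R :> R.
Proof. by rewrite ler1n ltnW// card_gt1. Qed.

Lemma Tate_theta_Tate f : Tate_theta f -> Tate f.
Proof.
move=> /Tate_thetaP h; apply/TateP.
exact: (null_at_radius_le hv _ card_ge1).
Qed.

Context (E : drinfeld_module K).

Lemma fps_sum_phi_t f x a : fps_sum f x a ->
  fps_sum (phi_t E f) x (phi_t E (a : C^o)).
Proof.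
move=> fa; apply: fps_sumD; first exact: fps_sumZ.
by apply: fps_sum_sum => i _; apply: fps_sumZ; exact: fps_sumX.
Qed.

Lemma phi_X f : phi E 'X f = phi_t E f.
Proof.
have F0 : Fq_Cinf K 0 = 0 by rewrite /Fq_Cinf /at_theta /kinf_Cinf !rmorph0.
have F1 : Fq_Cinf K 1 = 1 by rewrite /Fq_Cinf /at_theta /kinf_Cinf !rmorph1.
rewrite /phi size_polyX big_ord_recl big_ord1 /= !coefX /= F0 F1.
by rewrite scale0r add0r scale1r.
Qed.

Lemma phi_tB (x y : C) :
  phi_t E (x - y : C^o) = phi_t E (x : C^o) - phi_t E (y : C^o).
Proof.
rewrite !phi_tE mulrBr opprD addrACA; congr (_ + _).
by rewrite -sumrB; apply: eq_bigr => i _; rewrite exprqD exprqN mulrBr.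
Qed.

Lemma phi_t0 : phi_t E (0 : C^o) = (0 : C).
Proof. rewrite -[X in phi_t E X](subrr (0 : C)) phi_tB; exact: subrr. Qed.

(** The linear term dominates: with [B] bounding all |kappa_i|, every other term is at most B |d|^2
    < |d| <= |theta d| for small nonzero [d]. *)
Lemma absv_phi_t_small : exists2 rho : R, 0 < rho &
  forall d : C, v d < rho -> v (phi_t E (d : C^o)) = q%:R * v d.
Proof.
(* The summand 1 keeps [B] positive, so that its inverse can serve as a radius. *)
pose B : R := 1 + \sum_(i < rk E) v (kappa E i.+1).
have B0 : 0 < B by rewrite ltr_pwDl// sumr_ge0// => i _; exact: absv_ge0.
have HB (i : 'I_(rk E)) : v (kappa E i.+1) <= B.
  rewrite /B (bigD1 i)//= addrCA lerDl addr_ge0// sumr_ge0// => j _.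
  exact: absv_ge0.
exists (Num.min 1 B^-1); first by rewrite lt_min ltr01 invr_gt0.
move=> d; rewrite lt_min => /andP[d1 dB].
have [->|d0] := eqVneq d 0; first by rewrite phi_t0 !(absv0 hv) mulr0.
have vd : 0 < v d by rewrite (absv_gt0 hv).
rewrite phi_tE absvDl_eq// (absvalM hv) Cinf_abs_theta//.
apply: (@lt_le_trans _ _ (v d)); last by rewrite ler_peMl ?(ltW vd)// card_ge1.
apply: (absv_sum_lt hv) => // i _; rewrite (absvalM hv) (absvX hv).
have q2 : (1 < q ^ i.+1)%N by rewrite -(exp1n i.+1) ltn_exp2r// card_gt1.
apply: (@le_lt_trans _ _ (B * v d ^+ 2)).
  apply: ler_pM; rewrite ?HB ?exprn_ge0 ?(absv_ge0 hv)//.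
  by rewrite ler_wiXn2l ?(absv_ge0 hv) ?(ltW d1).
rewrite expr2 mulrA gtr_pMl// -ltr_pdivlMl//.
by rewrite mulr1.
Qed.

(** * Functional equation of the exponential and its behaviour near zero *)

Context (expE : fps C) (hexp : is_exp E expE).

(** Evaluates at [x] the formal identity [exp_phi] for the polynomial t. *)
Lemma exp_theta x a : fps_sum expE x a ->
  fps_sum expE (theta K * x) (phi_t E (a : C^o)).
Proof.
move=> xa; have [b hb] := exp_entire hexp (theta K * x).
have := fps_sum_dilate hb; rewrite (exp_phi hexp 'X) phi_X => hb'.
by rewrite (fps_sum_unique (fps_sum_phi_t xa) hb').
Qed.

(** Convergence at 1 bounds the coefficients by some [M]. Since q > 1, the coefficients in degrees 0
    and 1 are 0 and 1, so exp(y) - y starts in degree 2. *)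
Lemma exp_near0 : exists2 M : R, 0 < M &
  forall y a, v y <= 1 -> fps_sum expE y a -> v (a - y) <= M * v y ^+ 2.
Proof.
have [b hb] := exp_entire hexp 1.
have [M M0 HM] := eventually_small_bounded
  (@series_terms_null _ _ _ hv (fun i => expE i * 1 ^+ i) _ hb).
exists M => // y a y1 hy.
have hX : fps_sum fpsX y y.
  have := @fps_sum_finite fpsX y 2 _; rewrite big_ord_recl big_ord1 /= mul0r add0r mul1r.
  by apply; case=> [|[|n]].
have {}hy : fps_sum (expE + (-1) *: fpsX) y (a - y).
  by have := fps_sumD hy (fps_sumZ (-1) hX); rewrite mulN1r.
apply: (abs_cvg_le hv hy) => n; apply: (absv_sum_le hv).
  by rewrite mulr_ge0 ?exprn_ge0 ?(absv_ge0 hv)// ltW.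
move=> [[|[|i]] _] _ /=.
- rewrite (exp_modXq hexp) ?mulr0 ?addr0 ?mul0r ?absv0//.
    by rewrite mulr_ge0 ?exprn_ge0 ?(absv_ge0 hv)// ltW.
  by rewrite ltnW// card_gt1.
- rewrite (exp_modXq hexp) ?card_gt1//= mulr1 subrr mul0r absv0//.
  by rewrite mulr_ge0 ?exprn_ge0 ?(absv_ge0 hv)// ltW.
rewrite mulr0 addr0 (absvalM hv) (absvX hv) ler_pM ?exprn_ge0 ?(absv_ge0 hv)//.
  by have := HM i.+2; rewrite expr1n mulr1.
by rewrite ler_wiXn2l ?(absv_ge0 hv).
Qed.

End Evaluation.

(** * The exponential of the logarithm *)

Section ExpOfLog.
Context {F : finFieldType} {R : realType} {K : Cinf_tower F R}.
Local Notation q := #|F|.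
Local Notation C := (Cinf K).
Local Notation v := (@Cinf_abs F R K).
Context (E : drinfeld_module K).
Context (expE : fps C) (hexp : is_exp E expE).
Let hv := Cinf_absval K.

Lemma theta_neq0 : theta K != 0.
Proof.
by rewrite -(absv_gt0 hv) Cinf_abs_theta ltr0n ltnW// card_gt1.
Qed.

Lemma card_inv_expr_small (c : R) : 0 <= c ->
  eventually_small (fun n => c * (q%:R^-1) ^+ n.+1).
Proof.
move=> c0 e e0.
have q0 : 0 < q%:R :> R := card_gt0R.
have hs : eventually_small (fun n => (q%:R^-1 : R) ^+ n).
  apply: eventually_small_expr; rewrite ?invr_ge0 ?(ltW q0)//.
  by rewrite invf_lt1// ltr1n card_gt1.
have [N HN] := eventually_smallZ c0 hs e0.
by exists N => n Nn; apply: HN; exact: leqW.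
Qed.

Lemma backward_orbit_eq0 (d : nat -> C) :
  (forall n, phi_t E (d n.+1 : C^o) = d n) ->
  null_seq (v := v) (fun n => theta K ^+ n.+1 * d n) -> forall n, d n = 0.
Proof.
move=> dS hD.
have q0 : 0 < q%:R :> R := card_gt0R.
have vD n : v (theta K ^+ n.+1 * d n) = q%:R ^+ n.+1 * v (d n).
  by rewrite (absvalM hv) (absvX hv) Cinf_abs_theta.
have [rho rho0 hrho] := absv_phi_t_small E.
have [N HN] := hD rho rho0.
have dN n : (N <= n)%N -> v (d n) < rho.
  move=> Nn; apply: le_lt_trans (HN n Nn); rewrite vD ler_peMl ?(absv_ge0 hv)//.
  by rewrite exprn_ege1// card_ge1.
(* Beyond [N] each application of phi_t multiplies the absolute value by exactly q, which
   compensates the lost power of theta. *)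
have cst k : v (theta K ^+ (N + k).+1 * d (N + k)%N) = v (theta K ^+ N.+1 * d N).
  elim: k => [|k <-]; first by rewrite addn0.
  rewrite addnS !vD -(dS (N + k)%N) hrho; last by rewrite dN// -addnS leq_addr.
  by rewrite mulrA -exprSr.
have dN0 : d N = 0.
  suff /eqP : theta K ^+ N.+1 * d N = 0.
    by rewrite mulf_eq0 expf_eq0 (negbTE theta_neq0) => /eqP.
  apply: (absv_small_eq0 hv) => e e0; have [M HM] := hD e e0.
  by rewrite -(cst M); apply: HM; exact: leq_addl.
(* Zeros pass to smaller indices because phi_t(0) = 0, and to larger ones because the weighted
   absolute value is constant. *)
have down k : forall n, d (n + k)%N = 0 -> d n = 0.
  elim: k => [|k IH] n; first by rewrite addn0.
  by move=> h; apply: IH; rewrite -dS -addnS h phi_t0.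
have up n : d (N + n)%N = 0.
  apply/(absval_eq0 hv)/eqP; have := cst n; rewrite dN0 mulr0 absv0// vD.
  by move/eqP; rewrite mulf_eq0 expf_eq0 (gt_eqF q0).
by move=> n; apply: (down N); rewrite addnC.
Qed.

Lemma exp_division_limit (e : nat -> C) (G : fps C) (xi l : C) :
  (forall n, phi_t E (e n : C^o) = if n is n'.+1 then e n' else xi) ->
  (forall n, G n = theta K * e n - (if n is n'.+1 then e n' else 0)) ->
  fps_sum G (theta K) l -> fps_sum expE l xi.
Proof.
move=> he hG hl.
have GS n : \sum_(i < n.+1) G i * theta K ^+ i = theta K ^+ n.+1 * e n.
  elim: n => [|n IH]; first by rewrite big_ord1 hG subr0 mulr1.
  rewrite big_ord_recr /= IH hG mulrBl [e n * _]mulrC addrC subrK.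
  by rewrite mulrAC -exprS.
have [ex hex] := choice (exp_entire hexp).
(* The values exp(y_n) form a second backward orbit of phi_t, the one starting from exp(l); [d]
   compares the two orbits. *)
pose y n := l / theta K ^+ n.+1.
pose d n := e n - ex (y n).
have q0 : 0 < q%:R :> R := card_gt0R.
have tn n : theta K ^+ n != 0 by rewrite expf_neq0// theta_neq0.
have exy n : phi_t E (ex (y n.+1) : C^o) = ex (y n).
  apply: (fps_sum_unique _ (hex (y n))).
  have -> : y n = theta K * y n.+1.
    by rewrite /y (exprS _ n.+1) invfM mulrCA mulVKf ?theta_neq0.
  exact: (exp_theta hexp).
have d0 : forall n, d n = 0.
  apply: backward_orbit_eq0 => [n|eps eps0]; first by rewrite phi_tB he exy.
  have [M M0 HM] := exp_near0 hexp.
  have vy n : v (y n) = v l * q%:R^-1 ^+ n.+1.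
    by rewrite (absvalM hv) (absvV hv) (absvX hv) Cinf_abs_theta exprVn.
  (* [N1] ensures |y_n| < 1, as [exp_near0] requires; [N2] anticipates its error bound. *)
  have [N1 H1] := card_inv_expr_small (absv_ge0 hv l) ltr01.
  have Ml : 0 <= M * v l ^+ 2 by rewrite mulr_ge0 ?exprn_ge0 ?(absv_ge0 hv) ?ltW.
  have [N2 H2] := card_inv_expr_small Ml eps0.
  have /(abs_cvgP hv)/(_ eps eps0)[N3 H3] := hl.
  exists (maxn N1 (maxn N2 N3)) => n; rewrite !geq_max => /and3P[n1 n2 n3].
  (* The first difference tends to 0 by telescoping. The second is at most q^(n+1) M (|l|
     q^-(n+1))^2 = M |l|^2 q^-(n+1). *)
  have -> : theta K ^+ n.+1 * d n =
      (theta K ^+ n.+1 * e n - l) - theta K ^+ n.+1 * (ex (y n) - y n).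
    by rewrite !mulrBr /y [_ * (l / _)]mulrCA mulfV// mulr1 opprB addrA subrK.
  apply: (absvB_lt hv); first by rewrite -GS; apply: H3; exact: leqW.
  apply: le_lt_trans (H2 n n2).
  rewrite (absvalM hv) (absvX hv) Cinf_abs_theta.
  have := HM (y n) (ex (y n)) _ (hex _); rewrite vy => /(_ (ltW (H1 n n1))) hh.
  apply: (@le_trans _ _ (q%:R ^+ n.+1 * (M * (v l * q%:R^-1 ^+ n.+1) ^+ 2))).
    by rewrite ler_wpM2l ?exprn_ge0 ?(ltW q0).
  have b0 : q%:R ^+ n.+1 != 0 :> R by rewrite expf_neq0// gt_eqF.
  by rewrite exprVn le_eqVlt; apply/orP; left; apply/eqP; field.
rewrite -(he 0%N) -[e 0%N](subrK (ex (y 0%N))) -/(d 0%N) d0 add0r.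
have {1}-> : l = theta K * y 0%N by rewrite /y expr1 mulrCA mulfV ?mulr1 ?theta_neq0.
exact: (exp_theta hexp).
Qed.

(** * The extended logarithm as a fibre of the exponential *)

Context (Psi : 'M[fps C]_(rk E)) (hPsi : is_trivialization Psi).

(** The equation is solved coefficientwise. All but finitely many coefficients of [Z] are smaller
    than 1; there the solution is no larger than the coefficient, so decay at radius q persists. *)
Lemma wp_surj (Z : 'rV[fps C]_(rk E)) : mx_over (@Tate_theta F R K) Z ->
  exists u, mx_over (@Tate_theta F R K) u /\ wp u = Z.
Proof.
move=> hZ.
have [z hz] := choice (fun jn : 'I_(rk E) * nat => artin_schreier (Z 0 jn.1 jn.2)).
exists (\row_j Fps (fun n => z (j, n))); split.
  move=> i j; rewrite mxE; apply/Tate_thetaP => e e0.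
  have /Tate_thetaP hZj := hZ 0 j.
  (* [N1] gives the required smallness; beyond [N2] the coefficients have absolute value below 1,
     because the weights q^n are at least 1. *)
  have [N1 H1] := hZj e e0; have [N2 H2] := hZj 1 ltr01.
  exists (maxn N1 N2) => n; rewrite geq_max => /andP[n1 n2].
  have [_ /= hzn] := hz (j, n).
  apply: le_lt_trans (H1 n n1); rewrite ler_wpM2r ?exprn_ge0// hzn//.
  apply: le_lt_trans (H2 n n2); rewrite ler_peMr ?(absv_ge0 hv)//.
  by rewrite exprn_ege1// card_ge1.
apply/rowP => j; rewrite !mxE; apply: fpsP => n /=.
by have [/= <- _] := hz (j, n); rewrite expn1.
Qed.

Lemma mulmx_e1_tr (A : 'rV[fps C]_(rk E)) :
  (A *m (e1 E)^T) 0 0 = A 0 (Ordinal (rk_gt0 E)).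
Proof.
rewrite mxE (bigD1 (Ordinal (rk_gt0 E)))//= !mxE mulr1 big1 ?addr0// => i i0.
rewrite !mxE [_ == _](_ : _ = false) ?mulr0//.
by apply/negbTE; apply: contraNneq i0 => h; apply/eqP/val_inj.
Qed.

(** Valid for every admissible [u] and [l], which makes the logarithm independent of these choices
    modulo periods. *)
Lemma exp_log xi u l : L0 (xi%:A *: (e1 E *m Psi)) u ->
  fps_sum ((u *m invmx Psi *m (e1 E)^T) 0 0) (theta K) l -> fps_sum expE l xi.
Proof.
move=> [_ hu]; rewrite mulmx_e1_tr.
have [e [he hG]] := division_points hPsi hu.
exact: exp_division_limit.
Qed.

(** Both [Psi] and its inverse lie over T_theta, and [wp_surj] keeps [u] there, so the product
    converges at theta because |theta| = q. *)
Lemma log_exists xi : exists u l, L0 (xi%:A *: (e1 E *m Psi)) u /\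
  fps_sum ((u *m invmx Psi *m (e1 E)^T) 0 0) (theta K) l.
Proof.
have q0 : 0 < q%:R :> R := card_gt0R.
have hZ : mx_over (@Tate_theta F R K) (xi%:A *: (e1 E *m Psi)).
  move=> i j; apply/Tate_thetaP; rewrite mxE mulr_algl; apply: null_at_radiusZ => //.
  apply: null_at_radius_mulmx => // [i' j'|i' j'].
    by rewrite mxE; exact: null_at_radius_nat.
  exact/Tate_thetaP/(triv_Tate_theta hPsi).
have [u [uT hu]] := wp_surj hZ.
have [l hl] : exists l, fps_sum ((u *m invmx Psi *m (e1 E)^T) 0 0) (theta K) l.
  apply: null_radius_fps_sum; rewrite mulmx_e1_tr.
  apply: null_at_radius_mulmx => // i j; apply/Tate_thetaP; first exact: uT.
  exact: (triv_inv_Tate_theta hPsi).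
exists u, l; split=> //; split=> // i j; exact/Tate_theta_Tate/uT.
Qed.

(** Fibres of an additive map are cosets of its kernel; negation is the action of the scalar -1 of
    F_q. *)
Lemma coset_expE l xi : fps_sum expE l xi ->
  coset_of (period_lattice expE) l = [set y | fps_sum expE y xi].
Proof.
move=> hl; have [expD expZ] := exp_Fq_linear hexp.
apply/seteqP; split => y /=; rewrite /coset_of /period_lattice /= => hy.
  by have := expD _ _ _ _ hy hl; rewrite subrK add0r.
have FN1 : Fq_Cinf K (-1) = -1 by rewrite /Fq_Cinf /at_theta /kinf_Cinf !rmorphN1.
have := expD _ _ _ _ hy (expZ (-1) _ _ hl).
by rewrite FN1 !mulN1r subrr.
Qed.

(** The union defining [log_ext] collapses: by [exp_log] all its cosets are the same fibre, and
    [log_exists] shows that there is at least one. *)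
Lemma log_extE xi : log_ext expE Psi xi = [set y | fps_sum expE y xi].
Proof.
apply/seteqP; split => y /=.
  by move=> [u [l [hu hl]]]; rewrite (coset_expE (exp_log hu hl)).
move=> hy; have [u [l [hu hl]]] := log_exists xi; exists u, l; split => //.
by rewrite (coset_expE (exp_log hu hl)).
Qed.

End ExpOfLog.

(** Multiplication of a coset by theta is expressed through a representative [x]; its choice is
    immaterial, since theta maps periods to periods by [exp_theta]. *)
Theorem theorem3p9 (F : finFieldType) (R : realType) (K : Cinf_tower F R)
  (E : drinfeld_module K)
  (expE : fps (Cinf K)) (hexp : is_exp E expE)
  (Psi : 'M[fps (Cinf K)]_(rk E)) (hPsi : is_trivialization Psi)
  (xi : Cinf K) :
  exists x : Cinf K,
    log_ext expE Psi xi = coset_of (period_lattice expE) x /\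
    log_ext expE Psi (phi_t E (xi : (Cinf K)^o)) =
      coset_of (period_lattice expE) (theta K * x).
Proof.
(* Any value [x] of the logarithm at [xi] will do: exp(x) = xi implies exp(theta x) = phi_t(xi). *)
have [u [x [hu hx]]] := log_exists hPsi xi.
have ex := exp_log hexp hPsi hu hx.
exists x; split; rewrite (log_extE hexp hPsi).
  by rewrite (coset_expE hexp ex).
by rewrite (coset_expE hexp (exp_theta hexp ex)).
Qed.
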